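(* Let $N\ge1$, let $\ell:\mathbb{R}^{d\times d'}\to\mathbb{R}$ be analytic, and let $W(t)=W_N(t)\cdots W_1(t)$, $t\ge0$, be the product matrix of gradient flow with balanced initialization on the depth-$N$ factorization, with analytic singular value decomposition $W(t)=U(t)S(t)V^\top(t)$ (all as in the context). Then the signed singular values $\sigma_r(t)$ of $W(t)$ evolve by $$\dot\sigma_r(t) = -N\cdot\big(\sigma_r^2(t)\big)^{1-1/N}\cdot\big\langle\nabla\ell(W(t)),\,\mathbf{u}_r(t)\mathbf{v}_r^\top(t)\big\rangle,\qquad r=1,\dots,\min\{d,d'\}.$$ If the factorization is non-degenerate, i.e. has depth $N\ge2$, the singular values need not be signed: the analytic singular value decomposition may be taken such that $\sigma_r(t)\ge0$ for all $t$ and all $r$.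
   Context: Setting: $W_j\in\mathbb{R}^{d_j\times d_{j-1}}$ for $j=1,\dots,N$, with $d_N=d$, $d_0=d'$ and arbitrary hidden dimensions $d_1,\dots,d_{N-1}\in\mathbb{N}$; $\phi(W_1,\dots,W_N):=\ell(W_NW_{N-1}\cdots W_1)$. Gradient flow: $\dot W_j(t) = -\frac{\partial}{\partial W_j}\phi(W_1(t),\dots,W_N(t))$ for $t\ge0$, $j=1,\dots,N$. Balanced initialization: $W_{j+1}^\top(0)W_{j+1}(0)=W_j(0)W_j^\top(0)$ for $j=1,\dots,N-1$. Analytic singular value decomposition: $W(t)=U(t)S(t)V^\top(t)$ where $U(t)\in\mathbb{R}^{d\times\min\{d,d'\}}$, $S(t)\in\mathbb{R}^{\min\{d,d'\}\times\min\{d,d'\}}$, $V(t)\in\mathbb{R}^{d'\times\min\{d,d'\}}$ are analytic functions of $t$, and for every $t$ the matrices $U(t),V(t)$ have orthonormal columns while $S(t)$ is diagonal (its diagonal entries may be negative and in any order). Such a decomposition exists in this setting. The diagonal entries of $S(t)$ are the signed singular values $\sigma_1(t),\dots,\sigma_{\min\{d,d'\}}(t)$; the columns of $U(t)$ and $V(t)$ are denoted $\mathbf{u}_r(t)$ and $\mathbf{v}_r(t)$. $\langle A,B\rangle=\mathrm{tr}(A^\top B)$. For $N=1$ the factor $(\sigma_r^2)^{0}$ is $1$ (also when $\sigma_r=0$). *)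

(* Defs.v *)
From HB Require Import structures.
From mathcomp Require Import all_boot all_order all_algebra.
From mathcomp Require Import all_classical all_reals all_analysis.
From mathcomp.analysis.showcase Require summability.

Set Implicit Arguments.
Unset Strict Implicit.
Unset Printing Implicit Defensive.

Import Order.TTheory GRing.Theory Num.Theory.
Import numFieldNormedType.Exports.
Local Open Scope classical_set_scope.
Local Open Scope ring_scope.

Section Analyticity.
Variable R : realType.

(* A multi-index is a matrix of natural numbers. *)
Definition monomial m n (X : 'M[R]_(m, n)) (a : 'M[nat]_(m, n)) : R :=
  \prod_(i < m) \prod_(j < n) X i j ^+ a i j.

(* The power series is summed along the filter of finite sets of multi-indices,
   i.e. unconditionally (for real series, the same as absolutely). *)
Definition analytic_at m n (f : 'M[R]_(m, n) -> R) (A : 'M[R]_(m, n)) : Prop :=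
  exists c : 'M[nat]_(m, n) -> R, \forall B \near A,
    summability.partial_sum (fun a => c a * monomial (B - A) a)
      @ summability.totally --> f B.

Definition analytic m n (f : 'M[R]_(m, n) -> R) : Prop :=
  forall A, analytic_at f A.

(* Analyticity on the closed half-line: the values at negative times are
   irrelevant, and at time 0 the expansion is required on the right only. *)
Definition analytic_ge0 (f : R -> R) : Prop :=
  forall t0 : R, 0 <= t0 -> exists c : nat -> R, \forall t \near t0,
    0 <= t -> series (fun k => c k * (t - t0) ^+ k) @ \oo --> f t.

Definition analytic_mx_ge0 m n (F : R -> 'M[R]_(m, n)) : Prop :=
  forall i j, analytic_ge0 (fun t => F t i j).

End Analyticity.

(* Derivative of a function of t >= 0: two-sided for t > 0, right derivative
   at t = 0. *)
Definition has_derivative_ge0 (R : realType) (E : normedModType R)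
    (f : R -> E) (t : R) (df : E) : Prop :=
  h^-1 *: (f (t + h) - f t) @[h --> within [set h | 0 <= t + h] 0^'] --> df.

Definition gradient (R : realType) m n (f : 'M[R]_(m, n) -> R)
    (A : 'M[R]_(m, n)) : 'M[R]_(m, n) :=
  \matrix_(i, j) 'D_(delta_mx i j) f A.

Definition mxdot (R : realType) m n (A B : 'M[R]_(m, n)) : R :=
  \tr (A^T *m B).

Section Factorization.
Variables (R : realType) (dim : nat -> nat).

(* The factors are numbered from 0: [W j] is the matrix usually called
   W_(j+1), of size d_(j+1) x d_j.  In a factorization of depth N only
   W 0, ..., W N.-1 are used; the other components are ignored. *)
Definition factors := forall j : nat, 'M[R]_(dim j.+1, dim j).

Fixpoint product_matrix (W : factors) (N : nat) : 'M[R]_(dim N, dim 0%N) :=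
  if N is k.+1 then W k *m product_matrix W k else 1%:M.

Variables (N : nat) (l : 'M[R]_(dim N, dim 0%N) -> R).

Definition overparam_loss (W : factors) : R := l (product_matrix W N).

(* [dfwith W j X] is W with its j-th component replaced by X. *)
Definition partial_gradient (W : factors) (j : nat) :
    'M[R]_(dim j.+1, dim j) :=
  gradient (fun X : 'M[R]_(dim j.+1, dim j) => overparam_loss (dfwith W j X))
    (W j).

Definition gradient_flow (W : R -> factors) : Prop :=
  forall j, (j < N)%N -> forall t, 0 <= t ->
    has_derivative_ge0 (fun s => W s j) t (- partial_gradient (W t) j).

End Factorization.

Definition balanced (R : realType) (dim : nat -> nat) (N : nat)
    (W : factors R dim) : Prop :=
  forall j, (j.+1 < N)%N -> (W j.+1)^T *m W j.+1 = W j *m (W j)^T.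

(* The diagonal entries of S are neither required to be nonnegative nor
   ordered. *)
Definition analytic_svd (R : realType) m n (M : R -> 'M[R]_(m, n))
    (U : R -> 'M[R]_(m, minn m n)) (S : R -> 'M[R]_(minn m n))
    (V : R -> 'M[R]_(n, minn m n)) : Prop :=
  [/\ analytic_mx_ge0 U, analytic_mx_ge0 S, analytic_mx_ge0 V
    & forall t, 0 <= t ->
        [/\ (U t)^T *m U t = 1%:M, (V t)^T *m V t = 1%:M,
            is_diag_mx (S t) & M t = U t *m S t *m (V t)^T]].

(* Main.v *)
Require Import Defs.
From HB Require Import structures.
From mathcomp Require Import all_boot all_order all_algebra.
From mathcomp Require Import finmap.
From mathcomp Require Import all_classical all_reals all_analysis.
From mathcomp.analysis.showcase Require summability.
From mathcomp Require Import ring lra zify.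

Set Implicit Arguments.
Unset Strict Implicit.
Unset Printing Implicit Defensive.

Import Order.TTheory GRing.Theory Num.Theory.
Import numFieldNormedType.Exports.
Local Open Scope classical_set_scope.
Local Open Scope ring_scope.

(* Balancedness W_(j+1)^T W_(j+1) = W_j W_j^T is preserved by the flow, the two
   sides having equal derivatives. With A = W_N W_N^T and C = W_1^T W_1 it turns
   the gradient flow into W' = - sum_j A^(N-j) (grad l(W)) C^(j-1), while
   W W^T = A^N and W^T W = C^N. Since A and C are Gram matrices, the singular
   vectors u_r, v_r are eigenvectors of A and C themselves, with eigenvalue
   (sigma_r^2)^(1/N). Differentiating S = U^T W V, where the skew-symmetric
   matrices U^T U' and V^T V' do not contribute to the diagonal, gives
   sigma_r' = u_r^T W' v_r and the formula.
   For N >= 2 the exponent 2 (1 - 1/N) is at least 1, so near a zero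
   |sigma_r'| <= K |sigma_r| and sigma_r vanishes in a neighbourhood of that
   zero. Hence the sign of sigma_r is locally constant, so constant, and the
   negative ones are corrected by flipping the columns of U. *)

(** * Derivatives on the half-line *)

Section HalfLineDerivative.
Variable R : realType.
Implicit Types (f g : R -> R) (t s d K r e : R).

Local Notation admissible t := (within [set h : R | 0 <= t + h] (0 : R)^').

(** The increment [e / 2] is positive, hence nonzero and admissible even at the endpoint 0.
    Properness is what makes the derivative on the half-line unique. *)
Lemma admissible_proper t : 0 <= t -> ProperFilter (admissible t).
Proof.
move=> t0; apply: Build_ProperFilter_ex => P.
rewrite /within /= => /nbhs_ballP[e /= e0 He].
exists (e / 2); apply: He => /=.
- rewrite /ball /= sub0r normrN gtr0_norm ?divr_gt0//.
  by rewrite gtr_pMr// invf_lt1// ltr1n.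
- by rewrite gt_eqF// divr_gt0.
- by rewrite addr_ge0// divr_ge0// ltW.
Qed.

Lemma has_derivative_ge0E f t d :
  has_derivative_ge0 f t d <->
  (h^-1 * (f (t + h) - f t) @[h --> admissible t] --> d).
Proof. by []. Qed.

Lemma has_derivative_ge0_cvg f t d : has_derivative_ge0 f t d ->
  f (t + h) @[h --> admissible t] --> f t.
Proof.
move=> /has_derivative_ge0E fd.
have h0 : h @[h --> admissible t] --> (0 : R).
  by apply: cvg_within_filter; exact: cvg_within.
rewrite -[f t in X in _ --> X](addr0 (f t)) -[X in _ + X](mul0r d).
have -> : (fun h => f (t + h)) =
    (fun h => f t + h * (h^-1 * (f (t + h) - f t))).
  (* The identity is one of functions, so it must also hold at [h = 0], where both sides are
     [f t]. *)
  apply/funext => h; have [->|hn0] := eqVneq h 0.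
    by rewrite mul0r !addr0.
  by rewrite mulrA mulfV// mul1r [RHS]addrC subrK.
by apply: cvgD; [exact: cvg_cst|exact: cvgM].
Qed.

Lemma has_derivative_ge0_unique f t d1 d2 : 0 <= t ->
  has_derivative_ge0 f t d1 -> has_derivative_ge0 f t d2 -> d1 = d2.
Proof.
move=> t0 f1 f2; have FP := admissible_proper t0.
exact: (cvg_unique _ f1 f2).
Qed.

Lemma has_derivative_ge0_eq f g t d : 0 <= t -> (forall s, 0 <= s -> f s = g s) ->
  has_derivative_ge0 f t d -> has_derivative_ge0 g t d.
Proof.
move=> t0 fg /has_derivative_ge0E fd; apply/has_derivative_ge0E.
apply: cvg_trans fd; apply: near_eq_cvg; rewrite near_withinE.
by apply: nearW => h h0; rewrite !fg.
Qed.

Lemma has_derivative_ge0_cst c t : has_derivative_ge0 (fun=> c : R) t 0.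
Proof.
apply/has_derivative_ge0E; under eq_fun do rewrite subrr mulr0.
exact: cvg_cst.
Qed.

Lemma has_derivative_ge0D f g t d1 d2 :
  has_derivative_ge0 f t d1 -> has_derivative_ge0 g t d2 ->
  has_derivative_ge0 (fun s => f s + g s) t (d1 + d2).
Proof.
move=> /has_derivative_ge0E f1 /has_derivative_ge0E g2.
apply/has_derivative_ge0E.
under eq_fun do rewrite opprD addrACA mulrDr.
exact: cvgD.
Qed.

Lemma has_derivative_ge0N f t d : has_derivative_ge0 f t d ->
  has_derivative_ge0 (fun s => - f s) t (- d).
Proof.
move=> /has_derivative_ge0E fd; apply/has_derivative_ge0E.
under eq_fun do rewrite -opprD mulrN.
exact: cvgN.
Qed.

Lemma has_derivative_ge0M f g t d1 d2 :
  has_derivative_ge0 f t d1 -> has_derivative_ge0 g t d2 ->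
  has_derivative_ge0 (fun s => f s * g s) t (d1 * g t + f t * d2).
Proof.
move=> f1 g2; apply/has_derivative_ge0E.
have -> : (fun h => h^-1 * (f (t + h) * g (t + h) - f t * g t)) =
    (fun h => h^-1 * (f (t + h) - f t) * g (t + h)
              + f t * (h^-1 * (g (t + h) - g t))).
  apply/funext => h; rewrite [f t * (_ * _)]mulrCA -mulrA -mulrDr.
  by congr (_ * _); ring.
apply: cvgD; apply: cvgM => //; last exact: cvg_cst.
exact: has_derivative_ge0_cvg g2.
Qed.

Lemma has_derivative_ge0_sum (I : Type) (r : seq I) (F : I -> R -> R)
    (D : I -> R) t :
  (forall i, has_derivative_ge0 (F i) t (D i)) ->
  has_derivative_ge0 (fun s => \sum_(i <- r) F i s) t (\sum_(i <- r) D i).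
Proof.
move=> FD; elim: r => [|i r IH].
  have -> : (fun s => \sum_(i <- [::]) F i s) = fun=> 0.
    by apply/funext => s; rewrite big_nil.
  by rewrite big_nil; exact: has_derivative_ge0_cst.
have -> : (fun s => \sum_(j <- i :: r) F j s) =
    (fun s => F i s + \sum_(j <- r) F j s).
  by apply/funext => s; rewrite big_cons.
by rewrite big_cons; exact: has_derivative_ge0D.
Qed.

Lemma has_derivative_ge0_continuous f t d (e : R) :
  has_derivative_ge0 f t d -> 0 < e ->
  exists2 r : R, 0 < r & forall s, 0 <= s -> `|s - t| < r -> `|f s - f t| < e.
Proof.
move=> /has_derivative_ge0_cvg/cvgrPdist_lt Hf e0; have := Hf _ e0.
rewrite near_withinE => /nbhs_ballP[r /= r0 Hr]; exists r => // s s0 st.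
have [->|nst] := eqVneq s t; first by rewrite subrr normr0.
have := Hr (s - t); rewrite /ball /= sub0r normrN addrCA subrr addr0.
by move=> H; rewrite distrC; apply: H => //; rewrite subr_eq0.
Qed.

Lemma has_derivative_ge0_within_continuous f (df : R -> R) a b :
  (forall t, 0 <= t -> has_derivative_ge0 f t (df t)) -> 0 <= a ->
  {within `[a, b], continuous f}.
Proof.
move=> fd a0; apply/subspace_continuousP => x; rewrite /= in_itv /= => /andP[ax xb].
have x0 : 0 <= x by exact: le_trans ax.
apply/cvgrPdist_lt => e e0.
have [r r0 Hr] := has_derivative_ge0_continuous (fd x x0) e0.
rewrite near_withinE; apply/nbhs_ballP; exists r => //= y xy.
rewrite in_itv /= => /andP[ay _]; rewrite distrC; apply: Hr.
  exact: le_trans ay.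
by rewrite distrC.
Qed.

Lemma has_derivative_ge0_MVT f (df : R -> R) a b :
  (forall t, 0 <= t -> has_derivative_ge0 f t (df t)) -> 0 <= a -> a < b ->
  exists2 c, a < c < b & f b - f a = df c * (b - a).
Proof.
move=> fd a0 ab.
have [||c cab eqc] := @MVT R f df a b ab; last by exists c.
  move=> x; rewrite in_itv /= => /andP[ax xb].
  have x0 : 0 < x by exact: le_lt_trans ax.
  have /has_derivative_ge0E fx := fd x (ltW x0).
  (* At an interior point [x > 0], every [h] with [|h| < x] keeps [x + h] nonnegative, so the
     restricted limit is the ordinary two-sided derivative. *)
  have cx : h^-1 *: ((f \o shift x) (h *: (1 : R)) - f x) @[h --> 0^'] --> df x.
    move/cvgrPdist_lt in fx; apply/cvgrPdist_lt => e e0.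
    have := fx e e0; rewrite near_withinE => fxe; near=> h.
    rewrite /= [_ *: 1]mulr1 [h + x]addrC; near: h.
    apply: filter_app fxe; near=> h; apply; rewrite /= -lerBlDl sub0r.
    near: h; apply: cvg_within; apply/nbhs_ballP; exists x => //= h.
    by rewrite /ball /= sub0r normrN => /ltr_normlP[] hx _; rewrite lerNl ltW.
  by split; [apply/cvg_ex; exists (df x)|exact: cvg_lim].
exact: has_derivative_ge0_within_continuous fd a0.
Unshelve. all: by end_near.
Qed.

Lemma has_derivative_ge0_MVT_unordered f (df : R -> R) a b :
  (forall t, 0 <= t -> has_derivative_ge0 f t (df t)) -> 0 <= a -> 0 <= b ->
  exists2 c, Num.min a b <= c <= Num.max a b & f b - f a = df c * (b - a).
Proof.
move=> fd a0 b0; case: (ltgtP a b) => [ab|ba|->].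
- have [c /andP[ac cb] e] := has_derivative_ge0_MVT fd a0 ab.
  by exists c; rewrite ?ltW.
- have [c /andP[bc ca] e] := has_derivative_ge0_MVT fd b0 ba.
  by exists c; rewrite ?ltW// -opprB e -mulrN opprB.
- by exists b; rewrite ?lexx// !subrr mulr0.
Qed.

Lemma cvg_quotient_quadratic (P : set R) (g : R -> R) d K r : 0 < r ->
  (forall h, P h -> `|h| < r -> `|g h - d * h| <= K * h ^+ 2) ->
  h^-1 * g h @[h --> within P (0 : R)^'] --> d.
Proof.
move=> r0 gK; apply/cvgrPdist_lt => e e0.
have K0 : 0 < `|K| + 1 by rewrite ltr_wpDl.
rewrite near_withinE; apply/nbhs_ballP.
(* Dividing by [h] leaves an error at most [K * |h|]; the constant [|K| + 1] is positive whatever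
   the sign of [K]. *)
exists (Num.min r (e / (`|K| + 1))) => /=; first by rewrite lt_min r0 divr_gt0.
move=> h; rewrite /ball /= sub0r normrN lt_min => /andP[hr he] hn0 Ph.
have -> : d - h^-1 * g h = - (h^-1 * (g h - d * h)) by field.
rewrite normrN normrM normfV ltr_pdivrMl ?normr_gt0//.
apply: le_lt_trans (gK h Ph hr) _.
rewrite -[h ^+ 2]ger0_norm ?sqr_ge0// normrX expr2 mulrCA ltr_pM2l ?normr_gt0//.
apply: le_lt_trans (_ : (`|K| + 1) * `|h| < _).
  by rewrite ler_wpM2r// (le_trans (ler_norm _))// lerDl.
by rewrite mulrC -ltr_pdivlMr.
Qed.

Lemma has_derivative_ge0_quadratic f t d K r : 0 < r ->
  (forall h, 0 <= t + h -> `|h| < r ->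
    `|f (t + h) - f t - d * h| <= K * h ^+ 2) ->
  has_derivative_ge0 f t d.
Proof.
move=> r0 fK; apply/has_derivative_ge0E.
exact: (@cvg_quotient_quadratic _ (fun h => f (t + h) - f t) _ K r).
Qed.

Lemma cvg_series_terms_bounded (u : R^nat) (l : R) :
  series u @ \oo --> l -> exists2 M : R, 0 <= M & forall k, `|u k| <= M.
Proof.
move=> ul; have /cvgP/cvg_seq_bounded/pinfty_ex_gt0[M M0 uM] :=
  cvg_series_cvg_0 (cvgP _ ul).
by exists M => [|k]; [exact: ltW|exact: uM].
Qed.

Lemma sum_geometric_half_le2 n : \sum_(k < n) (2^-1 : R) ^+ k <= 2.
Proof.
have -> : \sum_(k < n) (2^-1 : R) ^+ k = 2 - 2 * 2^-1 ^+ n.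
  elim: n => [|n IH]; first by rewrite big_ord0 expr0 mulr1 subrr.
  by rewrite big_ord_recr /= IH exprS; field.
by rewrite gerBl mulr_ge0// exprn_ge0// invr_ge0.
Qed.

Lemma cvg_norm_le (T : Type) (F : set_system T) (FF : ProperFilter F)
    (u : T -> R) (l B : R) :
  u @ F --> l -> (\forall x \near F, `|u x| <= B) -> `|l| <= B.
Proof.
by move=> ul; apply: cvgr_to_le; exact: cvg_norm. Qed.

(** Abel's argument: the terms [c k * p ^+ k] are bounded by some [M], so for [|h| < p / 2] the
    terms of order at least 2 are dominated by a geometric series of ratio 1/2. The remainder after
    the affine part is then quadratic in [h], and [c 1] is the derivative. *)
Lemma analytic_ge0_derivable f t : analytic_ge0 f -> 0 <= t ->
  exists d, has_derivative_ge0 f t d.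
Proof.
move=> fa t0; have [c /nbhs_ballP[r /= r0 Hr]] := fa t t0.
have cvg_at h : `|h| < r -> 0 <= t + h ->
    series (fun k => c k * h ^+ k) @ \oo --> f (t + h).
  move=> hr th0; have := Hr (t + h); rewrite /ball /= opprD addrA subrr sub0r.
  by rewrite normrN [t + h - t]addrAC subrr add0r; apply.
pose p : R := r / 2.
have p0 : 0 < p by rewrite divr_gt0.
(* The series is evaluated at [t + p], to the right of [t], which is allowed also at [t = 0]. *)
have [M M0 cM] : exists2 M : R, 0 <= M & forall k, `|c k * p ^+ k| <= M.
  apply: (cvg_series_terms_bounded (cvg_at p _ _)).
    by rewrite gtr0_norm// gtr_pMr// invf_lt1// ltr1n.
  by rewrite addr_ge0// ltW.
have quad h : 0 <= t + h -> `|h| < p / 2 ->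
    `|f (t + h) - c 0%N - c 1%N * h| <= 2 * M / p ^+ 2 * h ^+ 2.
  move=> th0 hp.
  have hr : `|h| < r by apply: lt_le_trans hp _; rewrite /p; lra.
  have /cvgB/(_ (cvg_cst (c 0%N + c 1%N * h))) := cvg_at h hr th0.
  move=> /cvg_norm_le Hc; rewrite -[_ - _ - _]addrA -opprD; apply: Hc.
  exists 2%N => // -[|[|n]]// _.
  rewrite [X in `|X|](_ : _ =
    \sum_(0 <= k < n.+2) c k * h ^+ k - (c 0%N + c 1%N * h)); last by [].
  rewrite 2?big_nat_recl// expr0 mulr1 expr1.
  rewrite [X in `|X|](_ : _ = \sum_(0 <= i < n) c i.+2 * h ^+ i.+2); last first.
    by ring.
  apply: le_trans (ler_norm_sum _ _ _) _.
  have p0' := ltW p0; have pn0 : p != 0 by rewrite gt_eqF.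
  (* With [q = |h| / p <= 1/2], the factor [q ^+ 2] is kept for the quadratic bound and only
     [q ^+ i] is estimated by [2^-1 ^+ i]. *)
  have [q hq] : exists q : R, `|h| = p * q.
    by exists (`|h| / p); rewrite mulrCA mulfV// mulr1.
  have q0 : 0 <= q by rewrite -(pmulr_rge0 _ p0) -hq.
  have q2 : q <= 2^-1 by rewrite -(ler_pM2l p0) -hq ltW.
  have termle i : `|c i.+2 * h ^+ i.+2| <= M * q ^+ 2 * 2^-1 ^+ i.
    rewrite normrM normrX hq.
    have := cM i.+2; rewrite normrM normrX (gtr0_norm p0) => ci.
    have -> : `|c i.+2| * (p * q) ^+ i.+2 =
        `|c i.+2| * p ^+ i.+2 * q ^+ 2 * q ^+ i by rewrite exprMn !exprS; ring.
    apply: ler_pM.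
    - exact: mulr_ge0 (mulr_ge0 (normr_ge0 _) (exprn_ge0 _ p0')) (exprn_ge0 _ q0).
    - by rewrite exprn_ge0.
    - by rewrite ler_wpM2r ?exprn_ge0.
    - by rewrite lerXn2r// nnegrE// invr_ge0.
  rewrite big_mkord.
  apply: (@le_trans _ _ (\sum_(i < n) M * q ^+ 2 * 2^-1 ^+ i)).
    by apply: ler_sum => i _; exact: termle.
  rewrite -mulr_sumr.
  apply: le_trans (ler_wpM2l _ (sum_geometric_half_le2 n)) _.
    by rewrite mulr_ge0// exprn_ge0.
  rewrite -[h ^+ 2]real_normK ?num_real// hq le_eqVlt.
  by apply/orP; left; apply/eqP; field.
have f0 : f t = c 0%N.
  have := quad 0; rewrite addr0 expr0n /= !mulr0 subr0 normr0.
  by rewrite divr_gt0// normr_le0 subr_eq0 => /(_ t0 isT)/eqP.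
exists (c 1%N); apply: (@has_derivative_ge0_quadratic _ _ _ _ (p / 2)).
  by rewrite divr_gt0.
by move=> h th0 hp; rewrite f0; exact: quad.
Qed.

Lemma analytic_ge0_scale f (a : R) : analytic_ge0 f ->
  analytic_ge0 (fun t => f t * a).
Proof.
move=> fa t t0; have [c cf] := fa t t0; exists (fun k => c k * a).
apply: filterS cf => s /[apply] cs.
have -> : series (fun k => c k * a * (s - t) ^+ k) =
    (fun n => series (fun k => c k * (s - t) ^+ k) n * a).
  apply/funext => n; rewrite /series /= mulr_suml.
  by apply: eq_bigr => k _; rewrite mulrAC.
by apply: cvgM => //; exact: cvg_cst.
Qed.

Lemma has_derivative_ge0_constant f t :
  (forall s, 0 <= s -> has_derivative_ge0 f s 0) -> 0 <= t -> f t = f 0.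
Proof.
move=> f0 t0; move: (t0); rewrite le_eqVlt => /predU1P[->//|t1].
have [c _ /eqP] := has_derivative_ge0_MVT f0 (lexx 0) t1.
by rewrite mul0r subr_eq0 => /eqP.
Qed.

(* Grönwall in infinitesimal form: on an interval of length below 1 / K, the
   maximum of |f| is at most (K * length) times itself, hence zero. *)
Lemma zero_near_of_derivative_bound f (df : R -> R) t K r :
  (forall s, 0 <= s -> has_derivative_ge0 f s (df s)) -> 0 <= t -> 0 < r ->
  (forall s, 0 <= s -> `|s - t| < r -> `|df s| <= K * `|f s|) -> f t = 0 ->
  exists2 e : R, 0 < e & forall s, 0 <= s -> `|s - t| < e -> f s = 0.
Proof.
move=> fd t0 r0 fK ft0; have K0 : 0 < `|K| + 1 by rewrite ltr_wpDl.
(* This radius makes [(|K| + 1)] times the length of the interval at most 1/2. *)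
exists (Num.min r (2 * (`|K| + 1))^-1) => [|s s0].
  by rewrite lt_min r0 invr_gt0 mulr_gt0.
rewrite lt_min => /andP[str stK].
pose a := Num.min s t; pose b := Num.max s t.
have a0 : 0 <= a by rewrite le_min s0.
have ab : a <= b by rewrite ge_min !le_max lexx.
have near_t x : a <= x <= b -> `|x - t| <= `|s - t|.
  rewrite /a /b; case: (ltgtP s t) => st /andP[ax xb].
  - rewrite (ltr0_norm (x := s - t)) ?subr_lt0// ler_norml.
    by apply/andP; split; lra.
  - rewrite (gtr0_norm (x := s - t)) ?subr_gt0// ler_norml.
    by apply/andP; split; lra.
  - by rewrite -st subrr normr0 normr_le0 subr_eq0 eq_le xb ax.
have cf : {within `[a, b], continuous (fun x => `|f x|)}.
  move=> x; apply: cvg_norm.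
  exact: (has_derivative_ge0_within_continuous (b := b) fd a0).
have [c] := EVT_max ab cf; rewrite in_itv /= => cab cmax.
have c0 : 0 <= c by case/andP: cab => + _; exact: le_trans.
(* Since [f t = 0], the maximum [|f c|] equals [|df x| * |c - t|] for some [x] between [t] and [c],
   and [|df x| <= K * |f x|] with [|f x| <= |f c|]. *)
have [x xtc fct] := has_derivative_ge0_MVT_unordered fd t0 c0.
have xab : a <= x <= b.
  have /andP[tcx xtc'] := xtc; have /andP[ac cb] := cab; apply/andP; split.
    by apply: le_trans tcx; rewrite le_min ac ge_min lexx orbT.
  by apply: (le_trans xtc'); rewrite ge_max cb le_max lexx orbT.
have x0 : 0 <= x by case/andP: xab => + _; exact: le_trans.
suff fc0 : `|f c| <= 0.
  apply/eqP; rewrite -normr_le0; apply: le_trans fc0; apply: cmax.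
  by rewrite in_itv /= ge_min le_max !lexx.
suff : `|f c| <= 2^-1 * `|f c| by lra.
move: fct; rewrite ft0 subr0 => {1}->; rewrite normrM.
have cK : `|c - t| * (`|K| + 1) <= 2^-1.
  have := le_lt_trans (near_t c cab) stK.
  by rewrite invfM -ltr_pdivrMr ?invr_gt0// invrK => /ltW.
apply: (@le_trans _ _ ((`|K| + 1) * `|f c| * `|c - t|)).
  rewrite ler_wpM2r//; apply: le_trans (fK x x0 _) _.
    exact: le_lt_trans (near_t x xab) str.
  apply: (@le_trans _ _ ((`|K| + 1) * `|f x|)).
    by rewrite ler_wpM2r// (le_trans (ler_norm _))// lerDl.
  by rewrite ler_pM2l//; apply: cmax; rewrite in_itv.
by rewrite mulrAC [_ * `|c - t|]mulrC ler_wpM2r.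
Qed.

(** The sign is locally constant: near a zero by hypothesis, elsewhere by continuity. Its derivative
    is therefore 0 everywhere, and the mean value theorem takes the place of a connectedness
    argument. *)
Lemma sign_constant f (df : R -> R) t :
  (forall s, 0 <= s -> has_derivative_ge0 f s (df s)) ->
  (forall s, 0 <= s -> f s = 0 -> exists2 e : R, 0 < e &
     forall u, 0 <= u -> `|u - s| < e -> f u = 0) ->
  0 <= t -> Num.sg (f t) = Num.sg (f 0).
Proof.
move=> fd f0 t0.
apply: (@has_derivative_ge0_constant (fun s => Num.sg (f s))) => // s s0.
suff [e e0 He] : exists2 e : R, 0 < e &
    forall u, 0 <= u -> `|u - s| < e -> Num.sg (f u) = Num.sg (f s).
  apply: (@has_derivative_ge0_quadratic _ _ _ 0 e) => // h sh0 he.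
  rewrite (He _ sh0); last by rewrite [s + h]addrC addrK.
  by rewrite subrr !mul0r subr0 normr0.
have [fs0|fs0] := eqVneq (f s) 0.
  have [e e0 He] := f0 s s0 fs0.
  by exists e => // u u0 us; rewrite He ?fs0.
have [|e e0 He] := has_derivative_ge0_continuous (e := `|f s|) (fd s s0).
  by rewrite normr_gt0.
exists e => // u u0 us; have := He u u0 us.
rewrite ltr_norml => /andP[lu ru].
have [fsp|fsn|fs0'] := ltrgt0P (f s); last by rewrite fs0' eqxx in fs0.
- by rewrite (gtr0_norm fsp) in lu ru; rewrite !gtr0_sg//; lra.
- by rewrite (ltr0_norm fsn) in lu ru; rewrite !ltr0_sg//; lra.
Qed.

End HalfLineDerivative.

(** * Entrywise derivatives of matrix functions *)

Definition mx_derivative_ge0 (R : realType) m n (F : R -> 'M[R]_(m, n)) (t : R)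
    (D : 'M[R]_(m, n)) : Prop :=
  forall i j, has_derivative_ge0 (fun s => F s i j : R) t (D i j).

Section MatrixDerivative.
Variable R : realType.

(** Coordinates are continuous, so the limit in norm used by [gradient_flow] passes to the entries,
    where the scalar rules apply. *)
Lemma mx_derivative_ge0_of m n (F : R -> 'M[R]_(m, n)) t D :
  has_derivative_ge0 F t D -> mx_derivative_ge0 F t D.
Proof.
move=> FD i j; apply/has_derivative_ge0E.
rewrite /has_derivative_ge0 in FD.
have := cvg_comp _ _ FD (@coord_continuous R m n i j D).
rewrite (_ : _ \o _ = fun h => h^-1 * (F (t + h) i j - F t i j))//.
by apply/funext => h /=; rewrite !mxE.
Qed.

Lemma mx_derivative_ge0_tr m n (F : R -> 'M[R]_(m, n)) t D :
  mx_derivative_ge0 F t D -> mx_derivative_ge0 (fun s => (F s)^T) t D^T.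
Proof.
move=> FD i j; rewrite mxE; have := FD j i.
by congr (has_derivative_ge0 _ _ _); apply/funext => s; rewrite mxE.
Qed.

Lemma mx_derivative_ge0_mulmx m n p (F : R -> 'M[R]_(m, n))
    (G : R -> 'M[R]_(n, p)) t D E :
  mx_derivative_ge0 F t D -> mx_derivative_ge0 G t E ->
  mx_derivative_ge0 (fun s => F s *m G s) t (D *m G t + F t *m E).
Proof.
move=> FD GE i j; rewrite !mxE -big_split /=.
have -> : (fun s => (F s *m G s) i j) = (fun s => \sum_k F s i k * G s k j).
  by apply/funext => s; rewrite mxE.
by apply: has_derivative_ge0_sum => k; exact: has_derivative_ge0M.
Qed.

End MatrixDerivative.

(** * Gradients of analytic functions *)

Section UnconditionalSums.
Variables (R : realType) (I : choiceType).
Implicit Types (u : I -> R) (A B F G H : {fset I}).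

Lemma partial_sumE u G : summability.partial_sum u G = \sum_(a <- G) u a.
Proof. by rewrite big_seq_fsetE. Qed.

Lemma big_fset_split u A B : (A `<=` B)%fset ->
  \sum_(a <- B) u a = \sum_(a <- A) u a + \sum_(a <- (B `\` A)%fset) u a.
Proof.
move=> AB; rewrite (big_fsetID _ (mem A)) /=.
congr (_ + _); apply: eq_fbigl => x; rewrite !inE /=; last exact: andbC.
by case: (boolP (x \in A)) => [/(fsubsetP AB) ->|_]; rewrite ?andbF.
Qed.

(** Partial sums over finite sets containing [F0] are within 1 of the limit, so a finite set
    disjoint from [F0] has a sum of absolute value at most 2. Splitting such a set by the sign of
    its terms bounds its absolute sum by 4. *)
Lemma partial_sum_cvg_abs_bounded u (l : R) :
  summability.partial_sum u @ summability.totally --> l ->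
  exists2 K : R, 0 <= K & forall G, \sum_(a <- G) `|u a| <= K.
Proof.
have totF := @summability.totally_filter I.
move=> /cvgrPdist_lt/(_ 1 ltr01)[F0 _ HF].
have bound2 H : (forall x, x \in H -> x \notin F0) -> `|\sum_(a <- H) u a| <= 2.
  move=> HF0; have F0H : (F0 `<=` F0 `|` H)%fset by exact: fsubsetUl.
  have := HF _ F0H; have := HF _ (fsubset_refl F0).
  rewrite /= !partial_sumE (big_fset_split u F0H).
  have -> : ((F0 `|` H) `\` F0)%fset = H.
    apply/fsetP => x; rewrite !inE; case: (boolP (x \in F0)) => //= xF0.
    by apply/esym/negbTE/negP => /HF0; rewrite xF0.
  move: (\sum_(a <- H) _) (\sum_(a <- F0) _) => x y.
  by rewrite !ltr_norml ler_norml => /andP[? ?] /andP[? ?]; apply/andP; split; lra.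
exists (\sum_(a <- F0) `|u a| + 4) => [|G].
  by rewrite addr_ge0// sumr_ge0.
have GFG : (G `<=` F0 `|` G)%fset by exact: fsubsetUr.
have FFG : (F0 `<=` F0 `|` G)%fset by exact: fsubsetUl.
apply: (@le_trans _ _ (\sum_(a <- (F0 `|` G)%fset) `|u a|)).
  by rewrite (big_fset_split _ GFG) lerDl sumr_ge0.
rewrite (big_fset_split _ FFG) lerD2l; set H := (_ `\` _)%fset.
rewrite (big_fsetID _ (fun x => 0 <= u x)) /=.
have disj (P : pred I) x : x \in [fset x in H | P x]%fset -> x \notin F0.
  by rewrite !inE /= => /andP[/andP[]].
have := bound2 _ (@disj (fun x => 0 <= u x)).
have := bound2 _ (@disj (fun x => ~~ (0 <= u x))).
rewrite [X in _ -> _ -> X + _ <= _](_ : _ =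
    \sum_(a <- [fset x in H | 0 <= u x]%fset) u a); last first.
  rewrite big_seq [RHS]big_seq; apply: eq_bigr => x.
  by rewrite !inE /= => /andP[_ /ger0_norm].
rewrite [X in _ -> _ -> _ + X <= _](_ : _ =
    - \sum_(a <- [fset x in H | ~~ (0 <= u x)]%fset) u a); last first.
  rewrite -sumrN big_seq [RHS]big_seq; apply: eq_bigr => x.
  by rewrite !inE /= -ltNge => /andP[_ /ltr0_norm].
by rewrite !ler_norml => /andP[? ?] /andP[? ?]; lra.
Qed.

End UnconditionalSums.

(** * Size and Lipschitz bounds for monomials *)

Section Monomials.
Variables (R : realType) (m n : nat).
Implicit Types (X Y : 'M[R]_(m, n)) (a : 'M[nat]_(m, n)).

Definition mdegree a : nat := \sum_(i < m) \sum_(j < n) a i j.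

(* For entries at distance at most e q, the Lipschitz bound d e^(d-1) (e q) is
   written d e^d q; in this form the three bounds are stable under products. *)
Let close (e q x y : R) (d : nat) : Prop :=
  [/\ `|x| <= e ^+ d, `|y| <= e ^+ d & `|x - y| <= d%:R * e ^+ d * q].

Lemma close_mul e q x1 y1 d1 x2 y2 d2 : 0 <= e -> 0 <= q ->
  close e q x1 y1 d1 -> close e q x2 y2 d2 ->
  close e q (x1 * x2) (y1 * y2) (d1 + d2)%N.
Proof.
move=> e0 q0 [bx1 by1 d1q] [bx2 by2 d2q]; split.
- by rewrite normrM exprD ler_pM.
- by rewrite normrM exprD ler_pM.
- have -> : x1 * x2 - y1 * y2 = (x1 - y1) * x2 + y1 * (x2 - y2) by ring.
  apply: le_trans (ler_normD _ _) _; rewrite !normrM natrD exprD.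
  have -> : (d1%:R + d2%:R) * (e ^+ d1 * e ^+ d2) * q =
    d1%:R * e ^+ d1 * q * e ^+ d2 + e ^+ d1 * (d2%:R * e ^+ d2 * q) by ring.
  by rewrite lerD// ler_pM.
Qed.

Lemma close_one e q : close e q 1 1 0.
Proof. by split; rewrite ?expr0 ?normr1// subrr normr0 mul0r mul0r. Qed.

Lemma close_monomial e q X Y a : 0 <= e -> 0 <= q ->
  (forall i j, `|X i j| <= e) -> (forall i j, `|Y i j| <= e) ->
  (forall i j, `|X i j - Y i j| <= e * q) ->
  close e q (monomial X a) (monomial Y a) (mdegree a).
Proof.
move=> e0 q0 Xe Ye XY; rewrite /monomial /mdegree.
elim/big_ind3 : _ => [|*|i _]; [exact: close_one|exact: close_mul|].
elim/big_ind3 : _ => [|*|j _]; [exact: close_one|exact: close_mul|].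
elim: (a i j) => [|k IH]; first exact: close_one.
rewrite !exprS -add1n; apply: close_mul => //.
by split; rewrite expr1// mul1r.
Qed.

Lemma monomial_bound e X a : 0 <= e -> (forall i j, `|X i j| <= e) ->
  `|monomial X a| <= e ^+ mdegree a.
Proof.
(* The case [Y = X], [q = 0], in which the distance bound is trivial. *)
move=> e0 Xe; have [] // := @close_monomial e 0 X X a e0 (lexx _) Xe Xe _.
by move=> i j; rewrite subrr normr0 mulr0.
Qed.

Lemma monomial_lipschitz e q X Y a : 0 <= e -> 0 <= q ->
  (forall i j, `|X i j| <= e) -> (forall i j, `|Y i j| <= e) ->
  (forall i j, `|X i j - Y i j| <= e * q) ->
  `|monomial X a - monomial Y a| <= (mdegree a)%:R * e ^+ mdegree a * q.
Proof. by move=> e0 q0 Xe Ye XY; have [] := close_monomial a e0 q0 Xe Ye XY. Qed.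

(** Evaluating a power series at a constant matrix thus produces the weights [e ^+ mdegree a] that
    dominate it on the box of entries at most [e]. *)
Lemma monomial_const (e : R) a : monomial (const_mx e) a = e ^+ mdegree a.
Proof.
rewrite /monomial /mdegree (big_morph _ (exprD e) (expr0 e)).
apply: eq_bigr => i _; rewrite (big_morph _ (exprD e) (expr0 e)).
by apply: eq_bigr => j _; rewrite mxE.
Qed.

Definition unit_index (k : 'I_m) (l : 'I_n) : 'M[nat]_(m, n) :=
  \matrix_(i, j) ((i == k) && (j == l) : nat).

Lemma monomial_unit_index k l X : monomial X (unit_index k l) = X k l.
Proof.
rewrite /monomial (bigD1 k)//= (bigD1 l)//= mxE !eqxx expr1.
rewrite big1 ?mulr1 => [|j /negbTE jl]; last by rewrite mxE jl andbF expr0.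
rewrite big1 ?mulr1// => i /negbTE ik.
by rewrite big1// => j _; rewrite mxE ik expr0.
Qed.

Lemma monomial_0 X : monomial X (const_mx 0%N) = 1.
Proof. by rewrite /monomial big1// => i _; rewrite big1// => j _; rewrite mxE. Qed.

Lemma mdegree_le1 a : (mdegree a < 2)%N ->
  a = const_mx 0%N \/ exists k l, a = unit_index k l.
Proof.
move=> a2; have [/existsP[k /existsP[l akl]]|/existsPn a0] :=
  boolP [exists i, exists j, (0 < a i j)%N]; last first.
  left; apply/matrixP => i j; rewrite mxE.
  by have := a0 i => /existsPn/(_ j); rewrite lt0n negbK => /eqP.
right; exists k, l; apply/matrixP => i j; rewrite mxE.
move: a2; rewrite /mdegree (bigD1 k)//= (bigD1 l)//=.
have [->|ik] := eqVneq i k.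
  have [->|jl] := eqVneq j l; first by move=> /=; lia.
  rewrite [X in (_ + X + _)%N](bigD1 j)//=; lia.
rewrite [X in (_ + X)%N](bigD1 i)//= [X in (_ + (X + _))%N](bigD1 j)//=; lia.
Qed.

End Monomials.

(** * Differentiability and local gradient bounds *)

Section AnalyticGradient.
Variables (R : realType) (m n : nat).
Implicit Types (f : 'M[R]_(m, n) -> R) (A B X Y v : 'M[R]_(m, n)).

Lemma mx_near_entries (P : set 'M[R]_(m, n)) A : nbhs A P ->
  exists2 r : R, 0 < r & forall X, (forall i j, `|X i j| < r) -> P (A + X).
Proof.
move=> /nbhs_ballP[r /= r0 HP]; exists r => // X Xr; apply: HP; split=> // i j.
by rewrite /ball /= mxE opprD addrA subrr sub0r normrN.
Qed.

(* Both bounds follow from absolute summability of the power series at a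
   constant matrix. *)
Lemma analytic_at_estimates f A : analytic_at f A ->
  exists p K : R, exists L : 'M[R]_(m, n) -> R, [/\ 0 < p, 0 <= K,
    (forall X, L X = \sum_i \sum_j L (delta_mx i j) * X i j),
    (forall (e : R) X, 0 <= e <= p -> (forall i j, `|X i j| <= e) ->
       `|f (A + X) - f A - L X| <= K * e ^+ 2) &
    (forall (q : R) X Y, 0 <= q -> (forall i j, `|X i j| <= p) ->
       (forall i j, `|Y i j| <= p) -> (forall i j, `|X i j - Y i j| <= q) ->
       `|f (A + X) - f (A + Y)| <= K * q)].
Proof.
move=> [c /mx_near_entries[r r0 Hr]].
have totP := @summability.totally_filter 'M[nat]_(m, n).
have totF : Filter (@summability.totally 'M[nat]_(m, n)) by exact: _.
have cvgX X : (forall i j, `|X i j| < r) ->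
    summability.partial_sum (fun a => c a * monomial X a)
      @ summability.totally --> f (A + X).
  by move=> /Hr /=; rewrite addrAC subrr add0r.
pose p := r / 2; have p0 : 0 < p by rewrite divr_gt0.
have pr : p < r by rewrite /p; lra.
have pp : p / 2 <= p by lra.
have [K K0 HK] : exists2 K : R, 0 <= K &
    forall G : {fset 'M[nat]_(m, n)},
      \sum_(a <- G) `|c a| * p ^+ mdegree a <= K.
  have [|K K0 HK] := partial_sum_cvg_abs_bounded (cvgX (const_mx p) _).
    by move=> i j; rewrite mxE gtr0_norm.
  exists K => // G; apply: le_trans (HK G); apply: ler_sum => a _.
  by rewrite monomial_const normrM (ger0_norm (exprn_ge0 _ (ltW p0))).
(* Outside [F0] the differences of monomials are dominated by [b] times an absolutely summable
   series. This is used with [F0] the indices of degree at most 1 for the Taylor bound, and with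
   [F0] empty for the Lipschitz bound. *)
have diffbound X Y (F0 : {fset 'M[nat]_(m, n)}) (b : R) :
    (forall i j, `|X i j| < r) -> (forall i j, `|Y i j| < r) -> 0 <= b ->
    (forall a, a \notin F0 ->
       `|monomial X a - monomial Y a| <= b * p ^+ mdegree a) ->
    `|f (A + X) - f (A + Y)
      - \sum_(a <- F0) c a * (monomial X a - monomial Y a)| <= K * b.
  move=> Xr Yr b0 XYb.
  have cc := cvgB (cvgB (cvgX X Xr) (cvgX Y Yr))
     (cvg_cst (\sum_(a <- F0) c a * (monomial X a - monomial Y a))).
  apply: (cvg_norm_le totP (cc totF totF totF)); exists F0 => // G /= FG.
  rewrite [X in `|X|](_ : _ =
      \sum_(a <- (G `\` F0)%fset) c a * (monomial X a - monomial Y a)).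
    apply: le_trans (ler_norm_sum _ _ _) _.
    apply: (@le_trans _ _
      (\sum_(a <- (G `\` F0)%fset) `|c a| * p ^+ mdegree a * b)).
      rewrite big_seq [leRHS]big_seq; apply: ler_sum => a.
      rewrite !inE => /andP[aF0 _]; rewrite normrM -mulrA ler_wpM2l// mulrC.
      exact: XYb.
    by rewrite -mulr_suml ler_wpM2r.
  apply: (@eq_trans _ _ (summability.partial_sum (fun a => c a * monomial X a) G
    - summability.partial_sum (fun a => c a * monomial Y a) G
    - \sum_(a <- F0) c a * (monomial X a - monomial Y a))) => //.
  rewrite !partial_sumE -sumrB.
  under eq_bigr do rewrite -mulrBr.
  by rewrite (big_fset_split _ FG) addrAC subrr add0r.
(* The multi-indices of degree at most 1; all others have degree at least 2. *)
pose T1 : {fset 'M[nat]_(m, n)} :=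
  [fset a in const_mx 0%N ::
     [seq unit_index k l | k <- enum 'I_m, l <- enum 'I_n]]%fset.
have T1P a : a \in T1 -> a = const_mx 0%N \/ exists k l, a = unit_index k l.
  rewrite !inE => /orP[/eqP->|/allpairsP[[k l] [_ _ ->]]]; first by left.
  by right; exists k, l.
have T1C a : a \notin T1 -> (2 <= mdegree a)%N.
  apply: contraR; rewrite -ltnNge => /mdegree_le1[->|[k [l ->]]].
    by rewrite !inE eqxx.
  by rewrite !inE; apply/orP; right; apply: allpairs_f; rewrite mem_enum.
(* Halving [p] pays for the factor [mdegree a] in the Lipschitz bound of a monomial. The two
   summands serve the Taylor and the Lipschitz estimate respectively. *)
exists (p / 2), (2 * K / p ^+ 2 + 2 * K / p).
(* Subtracting the monomial at 0 removes the constant term, so that [L] is linear. *)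
exists (fun X => \sum_(a <- T1) c a * (monomial X a - monomial 0 a)).
have K1 : 0 <= 2 * K / p ^+ 2 by rewrite divr_ge0 ?mulr_ge0 ?exprn_ge0// ltW.
have K2 : 0 <= 2 * K / p by rewrite divr_ge0 ?mulr_ge0// ltW.
split.
- by rewrite divr_gt0.
- by rewrite addr_ge0.
- move=> X; under [RHS]eq_bigr do under eq_bigr do rewrite mulr_suml.
  under [RHS]eq_bigr do rewrite exchange_big /=.
  rewrite [RHS]exchange_big /= big_seq [RHS]big_seq.
  apply: eq_bigr => a /T1P[->|].
    rewrite !monomial_0 subrr mulr0 big1// => i _; rewrite big1// => j _.
    by rewrite !monomial_0 subrr mulr0 mul0r.
  move=> [k [l ->]]; rewrite !monomial_unit_index mxE subr0.
  rewrite (bigD1 k)//= (bigD1 l)//= !monomial_unit_index !mxE !eqxx subr0 mulr1.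
  rewrite big1 ?addr0 => [|j /negbTE jl]; last first.
    by rewrite !monomial_unit_index !mxE eq_sym jl andbF subr0 mulr0 mul0r.
  rewrite big1 ?addr0// => i /negbTE ik; rewrite big1// => j _.
  by rewrite !monomial_unit_index !mxE eq_sym ik subr0 mulr0 mul0r.
- move=> e X /andP[e0 ep] Xe; have ep' : e <= p by exact: le_trans pp.
  have := @diffbound X 0 T1 (2 * e ^+ 2 / p ^+ 2); rewrite addr0 => H.
  apply: le_trans (H _ _ _ _) _.
  + by move=> i j; apply: le_lt_trans (Xe i j) _; exact: le_lt_trans pr.
  + by move=> i j; rewrite mxE normr0.
  + by rewrite divr_ge0 ?mulr_ge0 ?exprn_ge0// ltW.
  + move=> a /T1C a2; apply: le_trans (ler_normB _ _) _.
    have Xa := monomial_bound a e0 Xe.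
    have Oa : `|monomial (0 : 'M[R]_(m, n)) a| <= e ^+ mdegree a.
      by apply: monomial_bound => // i j; rewrite mxE normr0.
    (* From degree 2 on, a factor [(e / p) ^+ 2] can be extracted because [e <= p]. *)
    have ea : e ^+ mdegree a <= e ^+ 2 / p ^+ 2 * p ^+ mdegree a.
      have pn0 : p != 0 by rewrite gt_eqF.
      rewrite -(subnK a2) !exprD; move: (mdegree a - 2)%N => d.
      have -> : e ^+ 2 / p ^+ 2 * (p ^+ d * p ^+ 2) = p ^+ d * e ^+ 2 by field.
      by rewrite ler_wpM2r ?exprn_ge0// lerXn2r// nnegrE// ltW.
    rewrite -[2 * _ / _]mulrA -[2 * _ * _]mulrA mulr_natl mulr2n.
    exact: lerD (le_trans Xa ea) (le_trans Oa ea).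
  + rewrite (_ : K * _ = 2 * K / p ^+ 2 * e ^+ 2); last by ring.
    by rewrite ler_wpM2r ?exprn_ge0// lerDl.
- move=> q X Y q0 Xe Ye XY.
  have := @diffbound X Y fset0 (2 * q / p).
  rewrite big_seq_fset0 subr0 => H; apply: le_trans (H _ _ _ _) _.
  + by move=> i j; apply: le_lt_trans (Xe i j) _; exact: le_lt_trans pr.
  + by move=> i j; apply: le_lt_trans (Ye i j) _; exact: le_lt_trans pr.
  + by rewrite divr_ge0 ?mulr_ge0// ltW.
  + move=> a _.
    have p20 : 0 <= p / 2 by rewrite divr_ge0// ltW.
    have pn0 : p != 0 by rewrite gt_eqF.
    have q20 : 0 <= 2 * q / p by rewrite divr_ge0 ?mulr_ge0// ltW.
    apply: le_trans (monomial_lipschitz a p20 q20 Xe Ye _) _.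
      by move=> i j; have -> : p / 2 * (2 * q / p) = q by field.
    (* The degree is absorbed by [d < 2 ^ d], which gives [d * (p / 2) ^+ d <= p ^+ d]. *)
    rewrite mulrC ler_wpM2l// expr_div_n mulrCA ler_piMr ?exprn_ge0 ?(ltW p0)//.
    rewrite ler_pdivrMr ?exprn_gt0// mul1r -natrX ler_nat ltnW//.
    exact: ltn_expl.
  + rewrite (_ : K * _ = 2 * K / p * q); last by ring.
    by rewrite ler_wpM2r// lerDr.
Qed.


Lemma mxdotE A B : mxdot A B = \sum_i \sum_j A i j * B i j.
Proof.
rewrite /mxdot /mxtrace exchange_big /=; apply: eq_bigr => i _.
by rewrite mxE; apply: eq_bigr => j _; rewrite mxE.
Qed.

Lemma mxdot_delta A i j : mxdot A (delta_mx i j) = A i j.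
Proof.
rewrite mxdotE (bigD1 i)//= (bigD1 j)//= [delta_mx _ _ _ _]mxE !eqxx mulr1.
rewrite !big1 ?addr0// => [k /negbTE ki|k /negbTE kj].
  by rewrite big1// => l _; rewrite [delta_mx _ _ _ _]mxE ki mulr0.
by rewrite [delta_mx _ _ _ _]mxE kj andbF mulr0.
Qed.

Lemma mx_entries_bounded v : exists2 M : R, 0 < M & forall i j, `|v i j| <= M.
Proof.
exists (1 + \sum_i \sum_j `|v i j|) => [|i j].
  by rewrite ltr_pwDl// sumr_ge0// => i _; rewrite sumr_ge0.
rewrite (bigD1 i)//= (bigD1 j)//=.
have s1 : 0 <= \sum_(k < n | k != j) `|v i k| by rewrite sumr_ge0.
have s2 : 0 <= \sum_(k < m | k != i) \sum_(l < n) `|v k l|.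
  by rewrite sumr_ge0// => k _; rewrite sumr_ge0.
by rewrite addrCA -addrA lerDl addr_ge0// addr_ge0.
Qed.

(** The quadratic remainder makes [L v] the derivative in every direction [v]. Its values at the
    [delta_mx i j] are the partial derivatives, so by linearity the gradient represents [L]. *)
Lemma analytic_at_cvg_derive f A v : analytic_at f A ->
  h^-1 *: (f (h *: v + A) - f A) @[h --> (0 : R)^'] -->
    mxdot (gradient f A) v.
Proof.
move=> /analytic_at_estimates[p [K [L [p0 K0 LE quad _]]]].
have cvgL w : h^-1 *: (f (h *: w + A) - f A) @[h --> (0 : R)^'] --> L w.
  have [M M0 wM] := mx_entries_bounded w.
  have pM : 0 < p / M by rewrite divr_gt0.
  have := @cvg_quotient_quadratic _ setT (fun h => f (h *: w + A) - f A) (L w)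
    (K * M ^+ 2) _ pM.
  rewrite (_ : within setT (0 : R)^' = (0 : R)^'); last first.
    apply/funext => Q; apply/propext; rewrite /within /=.
    by split => HQ; apply: filterS HQ => x; [apply|].
  apply => h _ hp.
  have -> : L w * h = L (h *: w).
    rewrite (LE w) (LE (h *: w)) mulr_suml; apply: eq_bigr => i _.
    by rewrite mulr_suml; apply: eq_bigr => j _; rewrite mxE mulrAC mulrA.
  rewrite [h *: w + A]addrC; apply: le_trans (quad (`|h| * M) _ _ _) _.
  - by rewrite mulr_ge0 ?(ltW M0)// -ler_pdivlMr ?ltW.
  - by move=> i j; rewrite mxE normrM ler_wpM2l.
  - by rewrite exprMn real_normK ?num_real// mulrA mulrAC.
have -> : mxdot (gradient f A) v = L v; last exact: cvgL.
rewrite mxdotE LE; apply: eq_bigr => i _; apply: eq_bigr => j _.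
by rewrite mxE; congr (_ * _); apply: cvg_lim => //; exact: cvgL.
Qed.

(** A local Lipschitz constant bounds all difference quotients along coordinate directions, hence
    their limits. *)
Lemma gradient_locally_bounded f A : analytic f ->
  exists2 r : R, 0 < r & exists2 K : R, 0 <= K & forall B,
    (forall i j, `|B i j - A i j| < r) ->
    forall i j, `|gradient f B i j| <= K.
Proof.
move=> fan; have [p [K [_ [p0 K0 _ _ lip]]]] := analytic_at_estimates (fan A).
exists (p / 2); first by rewrite divr_gt0.
exists K => // B Br i j.
have := @analytic_at_cvg_derive f B (delta_mx i j) (fan B).
rewrite mxdot_delta.
move=> /cvg_norm_le; apply; apply/nbhs_ballP.
exists (p / 2) => /=; first by rewrite divr_gt0.
move=> h; rewrite /ball /= sub0r normrN => hp hn0.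
rewrite [_ *: _]/(_ * _) normrM normfV ler_pdivrMl ?normr_gt0// mulrC.
have -> : h *: delta_mx i j + B = A + (B - A + h *: delta_mx i j).
  by rewrite addrA addrCA subrr addr0 addrC.
have BE : B = A + (B - A) by rewrite addrCA subrr addr0.
have hd k l : `|(h *: delta_mx i j : 'M[R]_(m, n)) k l| <= `|h|.
  by rewrite !mxE normrM ler_piMr//; case: (_ && _); rewrite ?normr1 ?normr0.
have BA k l : `|(B - A) k l| < p / 2 by rewrite !mxE; exact: Br.
rewrite [X in _ - f X]BE; apply: lip => // k l.
- rewrite mxE; apply: le_trans (ler_normD _ _) _.
  by have := BA k l; have := hd k l; lra.
- by have := BA k l; lra.
- by rewrite mxE [_ + _ k l]addrC addrK.
Qed.

End AnalyticGradient.

(** * Gradient flow on balanced factorizations *)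

Section PsdEigenvectors.
Variable R : realType.

Definition sqnorm n (w : 'cV[R]_n) : R := (w^T *m w) 0 0.

Lemma sqnormE n (w : 'cV[R]_n) : sqnorm w = \sum_i w i 0 ^+ 2.
Proof. by rewrite /sqnorm mxE; apply: eq_bigr => i _; rewrite mxE expr2. Qed.

Lemma sqnorm_ge0 n (w : 'cV[R]_n) : 0 <= sqnorm w.
Proof. by rewrite sqnormE sumr_ge0// => i _; rewrite sqr_ge0. Qed.

Lemma sqnorm_eq0 n (w : 'cV[R]_n) : sqnorm w = 0 -> w = 0.
Proof.
rewrite sqnormE => /eqP; rewrite psumr_eq0 => [/allP w0|i _]; last exact: sqr_ge0.
apply/matrixP => i j; rewrite ord1 mxE.
by have := w0 i (mem_index_enum i); rewrite sqrf_eq0 => /eqP.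
Qed.

Lemma trmx_exp n (A : 'M[R]_n) k : (A ^+ k)^T = A^T ^+ k.
Proof.
elim: k => [|k IH]; first by rewrite !expr0 [1%R]/(1%:M) trmx1.
by rewrite exprS exprSr -!mulmxE trmx_mul IH.
Qed.

Lemma mul_exp_mx n m (A : 'M[R]_n) (B : 'M[R]_(n, m)) i j :
  A ^+ i *m (A ^+ j *m B) = A ^+ (i + j) *m B.
Proof. by rewrite mulmxA mulmxE exprD. Qed.

Variables (n p : nat) (B : 'M[R]_(n, p)).
Let A : 'M[R]_n := B *m B^T.

Let trA k : (A ^+ k)^T = A ^+ k.
Proof. by rewrite trmx_exp /A trmx_mul trmxK. Qed.

(** With [i = k./2], the power is [A ^+ i *m A ^+ i] for even [k] and [A ^+ i *m B *m B^T *m A ^+ i]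
    for odd [k]; either way the form is a squared norm. *)
Lemma gram_exp_psd k (w : 'cV[R]_n) : 0 <= (w^T *m (A ^+ k *m w)) 0 0.
Proof.
have gram (M : 'M[R]_n) i (q : nat) (C : 'M[R]_(q, n)) :
    M = A ^+ i *m (C^T *m C) *m A ^+ i -> 0 <= (w^T *m (M *m w)) 0 0.
  move=> ->; have := sqnorm_ge0 (C *m (A ^+ i *m w)).
  by rewrite /sqnorm !trmx_mul trA !mulmxA.
rewrite -[k]odd_double_half; case: (odd k).
  apply: (gram _ k./2 _ B^T); rewrite trmxK -/A !mulmxE -exprSr -exprD.
  by congr (_ ^+ _); lia.
apply: (gram _ k./2 _ 1%:M); rewrite trmx1 mulmx1 mulmx1 mulmxE -exprD.
by congr (_ ^+ _); lia.
Qed.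

(** In the factorization of [A ^+ k.+1 - mu ^+ k.+1] as [A - mu] times the sum of the
    [mu ^+ (k - i) A ^+ i], every summand is positive semidefinite; only [i = 0] is kept. *)
Lemma gram_exp_sub_bound k (u : 'cV[R]_n) (mu : R) : 0 <= mu ->
  let w := A *m u - mu *: u in
  mu ^+ k * sqnorm w <= (w^T *m (A ^+ k.+1 *m u - mu ^+ k.+1 *: u)) 0 0.
Proof.
move=> mu0 /=; set w := A *m u - mu *: u.
elim: k => [|k IH]; first by rewrite !expr1 expr0 mul1r.
have -> : A ^+ k.+2 *m u - mu ^+ k.+2 *: u =
    A ^+ k.+1 *m w + mu *: (A ^+ k.+1 *m u - mu ^+ k.+1 *: u).
  rewrite /w mulmxBr scalerBr scalerA -exprS -scalemxAr mulmxA mulmxE -exprSr.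
  by rewrite addrA subrK.
rewrite mulmxDr -scalemxAr [leRHS]mxE [X in _ + X]mxE [in leLHS]exprS -mulrA.
by apply: ler_wpDl; [exact: gram_exp_psd|exact: ler_wpM2l].
Qed.

(** Handles the eigenvalue 0, where the previous bound is void for [k > 0]. Symmetry gives [|A ^+
    k.+1 u|^2 = <A ^+ k u, A ^+ k.+2 u>], which lowers the exponent step by step. *)
Lemma gram_exp_kernel k (u : 'cV[R]_n) : A ^+ k.+1 *m u = 0 -> A *m u = 0.
Proof.
elim: k => [|k IH] //= Au0; apply: IH; apply: sqnorm_eq0.
rewrite /sqnorm trmx_mul trA -mulmxA.
have -> : A ^+ k.+1 *m (A ^+ k.+1 *m u) = A ^+ k *m (A ^+ k.+2 *m u).
  by rewrite !mul_exp_mx addSnnS.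
by rewrite Au0 !mulmx0 mxE.
Qed.

Lemma gram_root_eigenvector k (u : 'cV[R]_n) (mu : R) : 0 <= mu ->
  A ^+ k.+1 *m u = mu ^+ k.+1 *: u -> A *m u = mu *: u.
Proof.
rewrite le_eqVlt => /predU1P[<-|mu0] Au.
  by rewrite scale0r; apply: (@gram_exp_kernel k); rewrite Au expr0n scale0r.
apply/eqP; rewrite -subr_eq0; apply/eqP; apply: sqnorm_eq0.
have := gram_exp_sub_bound k u (ltW mu0); rewrite /= Au subrr mulmx0 mxE.
rewrite pmulr_rle0 ?exprn_gt0// => w0.
by apply/eqP; rewrite eq_le w0 sqnorm_ge0.
Qed.

Lemma gram_exp_eigenvector k j (u : 'cV[R]_n) (mu : R) : 0 <= mu ->
  A ^+ k.+1 *m u = mu ^+ k.+1 *: u -> A ^+ j *m u = mu ^+ j *: u.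
Proof.
move=> mu0 /(gram_root_eigenvector mu0) Au; elim: j => [|j IH].
  by rewrite !expr0 scale1r [1%R]/(1%:M) mul1mx.
by rewrite exprS -mulmxE -mulmxA IH -scalemxAr Au scalerA -exprSr.
Qed.

End PsdEigenvectors.

(** * Partial products of balanced factors *)

Section Products.
Variables (R : realType) (dim : nat -> nat).
Implicit Types (W : factors R dim).

(* [tail_product W j N] is W (N-1) *m ... *m W j; the rectangular identity
   [pid_mx] gives the empty product a type without casts. *)
Fixpoint tail_product W (j N : nat) : 'M[R]_(dim N, dim j) :=
  if N is k.+1 then
    if (j <= k)%N then W k *m tail_product W j k else pid_mx (dim j)
  else pid_mx (dim j).

Lemma tail_product_id W N : tail_product W N N = 1%:M.
Proof. by case: N => [|N]; rewrite /= ?ltnn pid_mx_1. Qed.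

Lemma tail_productS W j N : (j <= N)%N ->
  tail_product W j N.+1 = W N *m tail_product W j N.
Proof. by move=> /= ->. Qed.

Lemma tail_productSl W j N : (j < N)%N ->
  tail_product W j N = tail_product W j.+1 N *m W j.
Proof.
elim: N => // N IH; rewrite ltnS leq_eqVlt => /predU1P[->|jN].
  by rewrite tail_productS// !tail_product_id mulmx1 mul1mx.
by rewrite !tail_productS ?(ltnW jN)// IH// mulmxA.
Qed.

Lemma product_matrix_split W j N : (j <= N)%N ->
  product_matrix W N = tail_product W j N *m product_matrix W j.
Proof.
elim: N => [|N IH].
  by rewrite leqn0 => /eqP ->; rewrite tail_product_id mul1mx.
rewrite leq_eqVlt => /predU1P[->|]; first by rewrite tail_product_id mul1mx.
by rewrite ltnS => jN; rewrite tail_productS//= IH// mulmxA.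
Qed.

Lemma tail_product_dfwith W j (X : 'M[R]_(dim j.+1, dim j)) N :
  tail_product (dfwith W j X) j.+1 N = tail_product W j.+1 N.
Proof.
elim: N => //= N IH; case: ifP => // jN.
by rewrite IH dfwithout// neq_ltn jN.
Qed.

Lemma product_matrix_dfwith_le W j (X : 'M[R]_(dim j.+1, dim j)) N :
  (N <= j)%N -> product_matrix (dfwith W j X) N = product_matrix W N.
Proof.
elim: N => //= N IH Nj; rewrite IH ?(ltnW Nj)// dfwithout//.
by rewrite neq_ltn Nj orbT.
Qed.

Lemma product_matrix_dfwith W j (X : 'M[R]_(dim j.+1, dim j)) N : (j < N)%N ->
  product_matrix (dfwith W j X) N =
  tail_product W j.+1 N *m X *m product_matrix W j.
Proof.
move=> jN; rewrite (product_matrix_split _ jN) /= tail_product_dfwith.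
by rewrite product_matrix_dfwith_le// dfwithin mulmxA.
Qed.

(** By [comm], balancedness turns [W i *m (W i)^T] into [(W i.+1)^T *m W i.+1], and repeating this
    carries it through the tail until it emerges on the left as the Gram matrix of the last factor.
    Each factor of the tail contributes one power. *)
Lemma balanced_tail_gram W N j : balanced N.+1 W -> (j <= N.+1)%N ->
  tail_product W j N.+1 *m (tail_product W j N.+1)^T =
  (W N *m (W N)^T) ^+ (N.+1 - j).
Proof.
move=> bal.
have comm k : forall i, (i + k)%N = N ->
    tail_product W i.+1 N.+1 *m (W i *m (W i)^T) =
    W N *m (W N)^T *m tail_product W i.+1 N.+1.
  elim: k => [|k IH] i.
    by rewrite addn0 => ->; rewrite tail_product_id mul1mx mulmx1.
  rewrite addnS -addSn => ikN.
  rewrite tail_productSl; last by lia.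
  rewrite -bal; last by lia.
  by rewrite mulmxA -[_ *m W _ *m _]mulmxA IH// mulmxA.
move=> jN; have : (j + (N.+1 - j))%N = N.+1 by rewrite subnKC.
move: (N.+1 - j)%N => k; elim: k j {jN} => [|k IH] j.
  by rewrite addn0 => ->; rewrite tail_product_id trmx1 mulmx1 expr0.
rewrite addnS -addSn => jkN; rewrite tail_productSl; last by lia.
rewrite trmx_mul mulmxA -[_ *m W _ *m _]mulmxA (comm k); last by lia.
by rewrite -mulmxA IH// exprS mulmxE.
Qed.

(** The mirror image: Gram matrices are carried down to the first factor, on the right. *)
Lemma balanced_product_gram W N j : balanced N.+1 W -> (j <= N.+1)%N ->
  (product_matrix W j)^T *m product_matrix W j = ((W 0%N)^T *m W 0%N) ^+ j.
Proof.
move=> bal.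
have comm i : (i <= N)%N -> (W i)^T *m W i *m product_matrix W i =
    product_matrix W i *m ((W 0%N)^T *m W 0%N).
  elim: i => [|i IH] iN; first by rewrite /= mulmx1 mul1mx.
  by rewrite bal //= -!mulmxA [(W i)^T *m _]mulmxA IH ?(ltnW iN)// !mulmxA.
elim: j => [|j IH] jN; first by rewrite /= trmx1 mulmx1 expr0.
rewrite /= trmx_mul mulmxA -[_ *m _ *m W j]mulmxA -mulmxA comm// mulmxA.
by rewrite IH ?(ltnW jN)// exprSr mulmxE.
Qed.

End Products.

(** * Evolution of the product matrix *)

Section Flow.
Variables (R : realType) (dim : nat -> nat).
Implicit Types (W : factors R dim).

Lemma product_matrix_derivative (W : R -> factors R dim) (D : factors R dim)
    t N :
  (forall j, (j < N)%N -> mx_derivative_ge0 (fun s => W s j) t (D j)) ->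
  mx_derivative_ge0 (fun s => product_matrix (W s) N) t
    (\sum_(j < N) tail_product (W t) j.+1 N *m D j *m product_matrix (W t) j).
Proof.
elim: N => [|N IH] WD.
  by rewrite big_ord0 => i j; rewrite [in X in has_derivative_ge0 _ _ X]mxE;
    exact: has_derivative_ge0_cst.
rewrite big_ord_recr /= ltnn pid_mx_1 mul1mx.
have -> : \sum_(i < N) (if (i < N)%N then W t N *m tail_product (W t) i.+1 N
      else pid_mx (dim i.+1)) *m D i *m product_matrix (W t) i =
    W t N *m \sum_(i < N)
      tail_product (W t) i.+1 N *m D i *m product_matrix (W t) i.
  by rewrite mulmx_sumr; apply: eq_bigr => i _; rewrite ltn_ord !mulmxA.
rewrite addrC; apply: mx_derivative_ge0_mulmx; first exact: WD.
by apply: IH => j jN; apply: WD; exact: ltnW.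
Qed.

(** The adjoint of [X] to [T *m X *m Q] for the trace inner product. *)
Lemma mxdot_mulmx m n p q (T : 'M[R]_(m, p)) (X : 'M[R]_(p, q))
    (Q : 'M[R]_(q, n)) (G : 'M[R]_(m, n)) :
  mxdot G (T *m X *m Q) = mxdot (T^T *m G *m Q^T) X.
Proof. by rewrite /mxdot !trmx_mul !trmxK mulmxA mxtrace_mulC !mulmxA. Qed.

(** The product is linear in its factor [j], so changing that factor along [delta_mx a b] moves the
    product along [T *m delta_mx a b *m P], with [T] and [P] the factors on either side. Taking the
    adjoint of this map reads off the entry. *)
Lemma partial_gradientE N (l : 'M[R]_(dim N, dim 0%N) -> R) W j :
  analytic l -> (j < N)%N ->
  partial_gradient l W j =
  (tail_product W j.+1 N)^T *m gradient l (product_matrix W N)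
    *m (product_matrix W j)^T.
Proof.
move=> lan jN; apply/matrixP => a b; rewrite [LHS]mxE.
rewrite -[RHS]mxdot_delta -mxdot_mulmx; apply: cvg_lim => //.
have := @analytic_at_cvg_derive _ _ _ l _
  (tail_product W j.+1 N *m delta_mx a b *m product_matrix W j)
  (lan (product_matrix W N)).
apply: cvg_trans; apply: near_eq_cvg; apply: nearW => h /=.
rewrite /overparam_loss !product_matrix_dfwith// mulmxDr mulmxDl.
by rewrite -scalemxAr -scalemxAl (product_matrix_split W jN) /= mulmxA.
Qed.

Section AlongFlow.
Variables (N : nat) (l : 'M[R]_(dim N, dim 0%N) -> R) (W : R -> factors R dim).
Hypotheses (lan : analytic l) (flow : gradient_flow l W)
  (bal0 : balanced N (W 0)).
Let G t := gradient l (product_matrix (W t) N).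

Lemma flow_mx_derivative j t : (j < N)%N -> 0 <= t ->
  mx_derivative_ge0 (fun s => W s j) t
    (- ((tail_product (W t) j.+1 N)^T *m G t *m (product_matrix (W t) j)^T)).
Proof.
move=> jN t0; rewrite -partial_gradientE//.
exact: mx_derivative_ge0_of (flow jN t0).
Qed.

Lemma flow_balanced t : 0 <= t -> balanced N (W t).
Proof.
move=> t0 j jN.
pose X s := (W s j.+1)^T *m W s j.+1; pose Y s := W s j *m (W s j)^T.
have jN' := ltnW jN.
have D s : 0 <= s -> mx_derivative_ge0 (fun s => X s - Y s) s 0.
  move=> s0.
  have Dj := flow_mx_derivative jN' s0; have Dj1 := flow_mx_derivative jN s0.
  set dWj := - _ in Dj; set dWj1 := - _ in Dj1.
  (* Both sides are minus the transposed tail from [j.+1], times the gradient, times the transposed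
     product of the first [j.+1] factors. *)
  have E : (W s j.+1)^T *m dWj1 = dWj *m (W s j)^T.
    rewrite /dWj /dWj1 mulmxN mulNmx; congr (- _).
    by rewrite (tail_productSl _ jN) /= !trmx_mul !mulmxA.
  have DX := mx_derivative_ge0_mulmx (mx_derivative_ge0_tr Dj1) Dj1.
  have DY := mx_derivative_ge0_mulmx Dj (mx_derivative_ge0_tr Dj).
  have E' : dWj1^T *m W s j.+1 = W s j *m dWj^T.
    by rewrite -[LHS]trmxK trmx_mul trmxK E trmx_mul trmxK.
  move=> a b.
  have := has_derivative_ge0D (DX a b) (has_derivative_ge0N (DY a b)).
  rewrite E E' (addrC (W s j *m dWj^T)) subrr mxE.
  by congr (has_derivative_ge0 _ _ _); apply/funext => u; rewrite !mxE.
apply/eqP; rewrite -subr_eq0; apply/eqP/matrixP => a b; rewrite [RHS]mxE.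
have D0 s : 0 <= s -> has_derivative_ge0 (fun u => (X u - Y u) a b) s 0.
  by move=> s0; have := D s s0 a b; rewrite mxE.
rewrite -[LHS]/((X t - Y t) a b) (has_derivative_ge0_constant D0 t0).
by rewrite /X /Y bal0// subrr mxE.
Qed.

End AlongFlow.

(** Inserting the flow into the Leibniz rule puts each outer partial product next to its own
    transpose, and balancedness evaluates these Gram matrices as powers. *)
Lemma flow_product_derivative n (l : 'M[R]_(dim n.+1, dim 0%N) -> R)
    (W : R -> factors R dim) t :
  analytic l -> gradient_flow l W -> balanced n.+1 (W 0) -> 0 <= t ->
  mx_derivative_ge0 (fun s => product_matrix (W s) n.+1) t
    (- \sum_(j < n.+1) (W t n *m (W t n)^T) ^+ (n - j)
         *m gradient l (product_matrix (W t) n.+1)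
         *m ((W t 0%N)^T *m W t 0%N) ^+ j).
Proof.
move=> lan flow bal0 t0; have bal := flow_balanced lan flow bal0 t0.
have := product_matrix_derivative
  (fun j jn => flow_mx_derivative lan flow jn t0).
congr (mx_derivative_ge0 _ _ _); rewrite -sumrN; apply: eq_bigr => j _.
rewrite mulmxN mulNmx -(balanced_product_gram bal (ltnW (ltn_ord j))).
have -> : (n - j)%N = (n.+1 - j.+1)%N by [].
by rewrite -(balanced_tail_gram bal (ltn_ord j)) !mulmxA.
Qed.

End Flow.

(** * Differentiating a singular value decomposition *)

Section SingularValues.
Variables (R : realType) (m n k : nat).
Implicit Types (M : R -> 'M[R]_(m, n)) (U : R -> 'M[R]_(m, k))
  (S : R -> 'M[R]_k) (V : R -> 'M[R]_(n, k)).

(** The diagonal entries of [U^T *m U] are constant, and their derivative is twice the entry in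
    question. *)
Lemma orthonormal_derivative_diag p (U : R -> 'M[R]_(p, k)) dU t r :
  (forall s, 0 <= s -> (U s)^T *m U s = 1%:M) -> 0 <= t ->
  mx_derivative_ge0 U t dU -> (dU^T *m U t) r r = 0.
Proof.
move=> UU t0 UD.
have D0 : has_derivative_ge0 (fun s => ((U s)^T *m U s) r r) t 0.
  apply: (@has_derivative_ge0_eq _ (fun=> (1%:M : 'M[R]_k) r r)) => // [s s0|].
    by rewrite UU.
  exact: has_derivative_ge0_cst.
have UUD := mx_derivative_ge0_mulmx (mx_derivative_ge0_tr UD) UD.
have := has_derivative_ge0_unique t0 D0 (UUD r r).
have -> : (U t)^T *m dU = (dU^T *m U t)^T by rewrite trmx_mul trmxK.
by rewrite [X in _ = X]mxE [(_^T) r r]mxE; lra.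
Qed.

Lemma diag_mul_entry (D X : 'M[R]_k) r : is_diag_mx D ->
  (X *m D) r r = X r r * D r r /\ (D *m X) r r = D r r * X r r.
Proof.
move=> /is_diag_mxP Dd; rewrite !mxE; split; rewrite (bigD1 r)//= big1 ?addr0//.
  by move=> i ir; rewrite Dd ?mulr0.
by move=> i ir; rewrite Dd ?mul0r// eq_sym.
Qed.

Lemma col_mul_mx p q (X : 'M[R]_(p, q)) (Y : 'M[R]_(q, k)) (r : 'I_k) :
  col r (X *m Y) = X *m col r Y.
Proof. by rewrite !colE mulmxA. Qed.

(* In the derivative of S = U^T M V the terms containing U' and V' vanish on
   the diagonal, because U^T U' and V^T V' are skew-symmetric. *)
Lemma singular_value_derivative M U S V dU dM dV t r :
  (forall s, 0 <= s -> [/\ (U s)^T *m U s = 1%:M, (V s)^T *m V s = 1%:M,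
     is_diag_mx (S s) & M s = U s *m S s *m (V s)^T]) -> 0 <= t ->
  mx_derivative_ge0 U t dU -> mx_derivative_ge0 M t dM ->
  mx_derivative_ge0 V t dV ->
  has_derivative_ge0 (fun s => S s r r : R) t
    (((col r (U t))^T *m dM *m col r (V t)) 0 0).
Proof.
move=> svd t0 UD MD VD.
have [UU VV Sd Mt] := svd t t0.
have SD := mx_derivative_ge0_mulmx (mx_derivative_ge0_mulmx
  (mx_derivative_ge0_tr UD) MD) VD.
have := @has_derivative_ge0_eq _ _ (fun s => S s r r) t _ t0 _ (SD r r).
have -> : ((dU^T *m M t + (U t)^T *m dM) *m V t + (U t)^T *m M t *m dV) r r =
    ((col r (U t))^T *m dM *m col r (V t)) 0 0.
  have MV : M t *m V t = U t *m S t by rewrite Mt -!mulmxA VV mulmx1.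
  have UM : (U t)^T *m M t = S t *m (V t)^T by rewrite Mt !mulmxA UU mul1mx.
  rewrite mulmxDl -[dU^T *m _ *m _]mulmxA MV UM mulmxA -[S t *m _ *m _]mulmxA.
  rewrite [LHS]mxE [X in X + _]mxE (diag_mul_entry _ _ Sd).1.
  rewrite (diag_mul_entry _ _ Sd).2.
  have -> : ((V t)^T *m dV) r r = 0.
    have -> : (V t)^T *m dV = (dV^T *m V t)^T by rewrite trmx_mul trmxK.
    rewrite mxE; apply: orthonormal_derivative_diag t0 VD.
    by move=> s /svd[].
  rewrite (orthonormal_derivative_diag r _ t0 UD); last by move=> s /svd[].
  rewrite mul0r mulr0 addr0 add0r tr_col -row_mul.
  by rewrite !mxE; apply: eq_bigr => i _; rewrite !mxE.
apply=> s s0; have [UU' VV' _ ->] := svd s s0.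
by rewrite !mulmxA UU' mul1mx -mulmxA VV' mulmx1.
Qed.

Lemma svd_gram_eigenvectors (M0 : 'M[R]_(m, n)) (U0 : 'M[R]_(m, k))
    (S0 : 'M[R]_k) (V0 : 'M[R]_(n, k)) r :
  U0^T *m U0 = 1%:M -> V0^T *m V0 = 1%:M -> is_diag_mx S0 ->
  M0 = U0 *m S0 *m V0^T ->
  M0 *m M0^T *m col r U0 = S0 r r ^+ 2 *: col r U0 /\
  M0^T *m M0 *m col r V0 = S0 r r ^+ 2 *: col r V0.
Proof.
move=> UU VV Sd ->.
have ScolE (p : nat) (X : 'M[R]_(p, k)) : X *m col r S0 = S0 r r *: col r X.
  apply/matrixP => i j; rewrite !mxE (bigD1 r)//= big1 ?addr0 => [|l lr].
    by rewrite mxE mulrC.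
  by move/is_diag_mxP : Sd => Sd; rewrite mxE Sd ?mulr0.
have ST : S0^T = S0.
  apply/matrixP => i j; rewrite mxE; have [->//|ij] := eqVneq i j.
  by move/is_diag_mxP : Sd => Sd; rewrite !Sd// eq_sym.
rewrite !trmx_mul trmxK ST -!col_mul_mx; split.
  have -> : U0 *m S0 *m V0^T *m (V0 *m (S0 *m U0^T)) *m U0 = U0 *m S0 *m S0.
    by rewrite -!mulmxA [V0^T *m _]mulmxA VV mul1mx UU mulmx1.
  by rewrite col_mul_mx ScolE col_mul_mx ScolE scalerA expr2.
have -> : V0 *m (S0 *m U0^T) *m (U0 *m S0 *m V0^T) *m V0 = V0 *m S0 *m S0.
  by rewrite -!mulmxA [U0^T *m _]mulmxA UU mul1mx VV mulmx1.
by rewrite col_mul_mx ScolE col_mul_mx ScolE scalerA expr2.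
Qed.

Lemma orthonormal_entry_le1 p (U : 'M[R]_(p, k)) i r :
  U^T *m U = 1%:M -> `|U i r| <= 1.
Proof.
move=> /matrixP/(_ r r); rewrite !mxE eqxx /=.
under eq_bigr do rewrite mxE -expr2.
rewrite (bigD1 i)//= => U1.
have : 0 <= \sum_(l < p | l != i) U l r ^+ 2.
  by apply: sumr_ge0 => l _; exact: sqr_ge0.
have : `|U i r| ^+ 2 = U i r ^+ 2 by rewrite real_normK ?num_real.
by rewrite -(@expr_le1 _ 2)//; lra.
Qed.

End SingularValues.

(** * Auxiliary estimates *)

Section Auxiliary.
Variable R : realType.

Lemma mxdot_outer p q (X : 'M[R]_(p, q)) (u : 'cV[R]_p) (v : 'cV[R]_q) :
  mxdot X (u *m v^T) = (u^T *m X *m v) 0 0.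
Proof.
rewrite /mxdot mulmxA mxtrace_mulC /mxtrace big_ord1.
have -> : u^T *m X *m v = (v^T *m (X^T *m u))^T by rewrite !trmx_mul !trmxK.
by rewrite [RHS]mxE.
Qed.

Lemma analytic_mx_ge0_derivable p q (F : R -> 'M[R]_(p, q)) t :
  analytic_mx_ge0 F -> 0 <= t -> exists D, mx_derivative_ge0 F t D.
Proof.
move=> Fan t0.
have /choice[d dP] : forall ij : 'I_p * 'I_q, exists d,
    has_derivative_ge0 (fun s => F s ij.1 ij.2 : R) t d.
  by move=> ij; exact: analytic_ge0_derivable (Fan _ _) t0.
by exists (\matrix_(i, j) d (i, j)) => i j; rewrite mxE; exact: (dP (i, j)).
Qed.

Lemma mx_derivative_ge0_continuous p q (F : R -> 'M[R]_(p, q)) D t (e : R) :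
  mx_derivative_ge0 F t D -> 0 < e ->
  exists2 r : R, 0 < r & forall s, 0 <= s -> `|s - t| < r ->
    forall i j, `|F s i j - F t i j| < e.
Proof.
move=> FD e0; have : \forall s \near t, forall i j,
    0 <= s -> `|F s i j - F t i j| < e.
  apply: (@filter_forall _ _
    (fun i s => forall j, 0 <= s -> `|F s i j - F t i j| < e)
    (nbhs t) (nbhs_filter t)) => i.
  apply: (@filter_forall _ _ (fun j s => 0 <= s -> `|F s i j - F t i j| < e)
    (nbhs t) (nbhs_filter t)) => j.
  have [r r0 Hr] := has_derivative_ge0_continuous (FD i j) e0.
  apply/nbhs_ballP; exists r => // s; rewrite /ball /= distrC => st s0.
  exact: Hr.
move=> /nbhs_ballP[r /= r0 Hr]; exists r => // s s0 st i j.
by apply: Hr => //; rewrite /ball /= distrC.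
Qed.

(** This is where depth at least 2 enters: the exponent is then at least 1/2, and powers of
    [x ^+ 2 <= 1] decrease in the exponent, with [|x|] the power 1/2. *)
Lemma powR_sqr_le_norm n (x : R) : (1 <= n)%N -> `|x| <= 1 ->
  (x ^+ 2) `^ (1 - n.+1%:R^-1) <= `|x|.
Proof.
move=> n1 x1; have n2 : n.+1%:R^-1 <= 2^-1 :> R.
  by rewrite lef_pV2 ?posrE ?ltr0n// ler_nat.
move: (n.+1%:R^-1) n2 => a a2.
have [->|x0] := eqVneq x 0.
  (* At [x = 0] the exponent has to be nonzero, because the power of 0 with exponent 0 is 1. *)
  by rewrite expr0n /= powR0 ?normr0// gt_eqF//; lra.
rewrite -(sqrtr_sqr x) -powR12_sqrt ?sqr_ge0//; apply: ger_powR; last by lra.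
by rewrite exprn_even_gt0//= x0 -[x ^+ 2]real_normK ?num_real//= exprn_ile1.
Qed.

End Auxiliary.

(** * Singular values along the flow *)

Section SingularValueFlow.
Variables (R : realType) (n : nat) (dim : nat -> nat).
Variables (l : 'M[R]_(dim n.+1, dim 0%N) -> R) (W : R -> factors R dim).
Let k := minn (dim n.+1) (dim 0%N).
Variables (U : R -> 'M[R]_(dim n.+1, k)) (S : R -> 'M[R]_k)
  (V : R -> 'M[R]_(dim 0%N, k)).
Hypotheses (lan : analytic l) (flow : gradient_flow l W)
  (bal0 : balanced n.+1 (W 0))
  (svd : analytic_svd (fun t => product_matrix (W t) n.+1) U S V).
Let G t := gradient l (product_matrix (W t) n.+1).

Let speed (r : 'I_k) (t : R) : R :=
  - (n.+1%:R * ((S t r r ^+ 2) `^ (1 - n.+1%:R^-1))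
     * mxdot (G t) (col r (U t) *m (col r (V t))^T)).

(** The singular vectors are eigenvectors of the [n.+1]-th powers of the two Gram matrices with
    eigenvalue [mu ^+ n.+1], and semidefiniteness lets the root be taken. *)
Lemma flow_gram_root_eigenvectors t r j : 0 <= t ->
  let mu := (S t r r ^+ 2) `^ n.+1%:R^-1 in
  (W t n *m (W t n)^T) ^+ j *m col r (U t) = mu ^+ j *: col r (U t) /\
  ((W t 0%N)^T *m W t 0%N) ^+ j *m col r (V t) = mu ^+ j *: col r (V t).
Proof.
move=> t0 mu; have [_ _ _ /(_ t t0)[UU VV Sd Wt]] := svd.
have bal := flow_balanced lan flow bal0 t0.
have [] := svd_gram_eigenvectors r UU VV Sd Wt.
have muE : mu ^+ n.+1 = S t r r ^+ 2.
  by rewrite -powR_mulrn ?powR_ge0// -powRrM mulVf ?powRr1 ?sqr_ge0//.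
have mu0 : 0 <= mu by exact: powR_ge0.
rewrite (balanced_product_gram bal (leqnn _)).
rewrite (product_matrix_split _ (leq0n n.+1)) mulmx1.
rewrite (balanced_tail_gram bal (leq0n _)) subn0 -muE => Ueig Veig.
split; first exact: gram_exp_eigenvector mu0 Ueig.
have := @gram_exp_eigenvector _ _ _ (W t 0%N)^T n j (col r (V t)) mu mu0.
by rewrite trmxK; apply.
Qed.

Lemma singular_value_speed r t : 0 <= t ->
  has_derivative_ge0 (fun s => S s r r : R) t (speed r t).
Proof.
move=> t0; have [Uan San Van svdt] := svd.
have [dU UD] := analytic_mx_ge0_derivable Uan t0.
have [dV VD] := analytic_mx_ge0_derivable Van t0.
have WD := flow_product_derivative lan flow bal0 t0.
have := singular_value_derivative (r := r) svdt t0 UD WD VD.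
congr (has_derivative_ge0 _ _ _).
rewrite /speed mxdot_outer -/(G t).
set u := col r (U t); set v := col r (V t).
pose mu := (S t r r ^+ 2) `^ n.+1%:R^-1.
(* For [n = 0] both sides are 1, also when the singular value is 0. *)
have -> : (S t r r ^+ 2) `^ (1 - n.+1%:R^-1) = mu ^+ n.
  rewrite -[RHS]powR_mulrn ?powR_ge0// /mu -powRrM; congr (_ `^ _).
  have -> : n%:R = n.+1%:R - 1 :> R by rewrite -natr1 addrK.
  by rewrite mulrBr mulr1 mulVf ?pnatr_eq0.
(* The factors [mu ^+ (n - j)] on the left and [mu ^+ j] on the right combine to the same [mu ^+ n]
   for every [j]; the [n.+1] equal terms yield the factor [N]. *)
have term (j : 'I_n.+1) : u^T *m ((W t n *m (W t n)^T) ^+ (n - j) *m G t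
    *m ((W t 0%N)^T *m W t 0%N) ^+ j) *m v = mu ^+ n *: (u^T *m G t *m v).
  have [Ue _] := flow_gram_root_eigenvectors r (n - j) t0.
  have [_ Ve] := flow_gram_root_eigenvectors r j t0.
  have Ue' : u^T *m (W t n *m (W t n)^T) ^+ (n - j) = mu ^+ (n - j) *: u^T.
    apply: trmx_inj; rewrite trmx_mul trmx_exp trmx_mul !trmxK Ue.
    by rewrite linearZ /= trmxK.
  rewrite 2!mulmxA Ue' -[LHS]mulmxA Ve -scalemxAr -!scalemxAl scalerA -exprD.
  by rewrite subnKC// -ltnS.
rewrite mulmxN mulNmx mulmx_sumr mulmx_suml (eq_bigr _ (fun j _ => term j)).
by rewrite sumr_const card_ord mxE -scaler_nat scalerA mxE.
Qed.

(** Near [t] the gradient entries are at most [K], those of the singular vectors at most 1, and the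
    singular value itself at most 1 in absolute value. The speed is then at most a constant times
    the singular value, and the Grönwall lemma applies. *)
Lemma singular_value_zero_near r t : (1 <= n)%N -> 0 <= t -> S t r r = 0 ->
  exists2 e : R, 0 < e & forall s, 0 <= s -> `|s - t| < e -> S s r r = 0.
Proof.
move=> n1 t0 St0.
have [p p0 [K K0 GK]] :=
  gradient_locally_bounded (product_matrix (W t) n.+1) lan.
have WD := flow_product_derivative lan flow bal0 t0.
have [p1 p10 W1] := mx_derivative_ge0_continuous WD p0.
have [p2 p20 S1] :=
  has_derivative_ge0_continuous (singular_value_speed (r := r) t0) ltr01.
apply: (@zero_near_of_derivative_bound _ (fun s => S s r r) (speed r) t
  (n.+1%:R * \sum_(i < dim n.+1) \sum_(j < dim 0%N) K) (Num.min p1 p2)) => //.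
- by move=> s s0; exact: singular_value_speed.
- by rewrite lt_min p10.
move=> s s0; rewrite lt_min => /andP[sp1 sp2].
have [_ _ _ /(_ s s0)[UU VV _ _]] := svd.
have Sle1 : `|S s r r| <= 1 by have := S1 s s0 sp2; rewrite St0 subr0 => /ltW.
rewrite /speed normrN !normrM normr_nat -!mulrA ler_wpM2l// mulrC.
apply: ler_pM => //; last by rewrite ger0_norm ?powR_ge0// powR_sqr_le_norm.
rewrite mxdotE; apply: le_trans (ler_norm_sum _ _ _) _.
apply: ler_sum => i _; apply: le_trans (ler_norm_sum _ _ _) _.
apply: ler_sum => j _; rewrite normrM -[K]mulr1; apply: ler_pM => //.
  by apply: GK => a b; exact: W1.
rewrite !mxE big_ord1 !mxE normrM -[1]mulr1.
by apply: ler_pM => //; apply: orthonormal_entry_le1.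
Qed.

(** Unlike [Num.sg] this is 1 at 0, so it always squares to 1 and the flipped columns remain
    orthonormal. *)
Let flip (r : 'I_k) : R := if S 0 r r < 0 then -1 else 1.

Lemma nonnegative_analytic_svd : (1 <= n)%N ->
  exists (U' : R -> 'M[R]_(dim n.+1, k)) (S' : R -> 'M[R]_k)
         (V' : R -> 'M[R]_(dim 0%N, k)),
    analytic_svd (fun t => product_matrix (W t) n.+1) U' S' V' /\
    (forall r (t : R), 0 <= t -> 0 <= S' t r r).
Proof.
move=> n1; have [Uan San Van svdt] := svd.
have flip2 r : flip r * flip r = 1.
  by rewrite /flip; case: ifP => _; rewrite ?mulrNN mulr1.
exists (fun t => \matrix_(i, r) (U t i r * flip r)),
  (fun t => \matrix_(q, r) (S t q r * flip q)), V.
split; last first.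
  move=> r t t0; rewrite mxE.
  have := sign_constant (singular_value_speed (r := r))
    (fun s s0 Ss0 => singular_value_zero_near n1 s0 Ss0) t0.
  rewrite /flip; have [S0|S0|S0] := ltgtP (S 0 r r) 0.
  - rewrite (ltr0_sg S0) => /eqP; rewrite sgr_cp0 => St.
    by rewrite mulrN1 oppr_ge0 ltW.
  - by rewrite (gtr0_sg S0) => /eqP; rewrite sgr_cp0 mulr1 => /ltW.
  (* A singular value that starts at 0 stays 0 for all time. *)
  - by rewrite S0 sgr0 => /eqP; rewrite sgr_eq0 => /eqP ->; rewrite mul0r.
split=> //.
- move=> i j; have := analytic_ge0_scale (flip j) (Uan i j).
  by congr (analytic_ge0 _); apply/funext => s; rewrite mxE.
- move=> i j; have := analytic_ge0_scale (flip i) (San i j).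
  by congr (analytic_ge0 _); apply/funext => s; rewrite mxE.
move=> t t0; have [UU VV Sd Wt] := svdt t t0; split => //.
- apply/matrixP => i j; rewrite mxE.
  under eq_bigr do rewrite !mxE mulrACA.
  rewrite -mulr_suml; have /matrixP/(_ i j) := UU.
  rewrite mxE; under eq_bigr do rewrite mxE.
  move=> ->; rewrite mxE; have [->|] := eqVneq i j; last by rewrite mul0r.
  by rewrite mul1r flip2.
- apply/is_diag_mxP => i j ij; rewrite mxE.
  by move/is_diag_mxP : Sd => ->//; rewrite mul0r.
- rewrite Wt; congr (_ *m _); apply/matrixP => i j; rewrite !mxE.
  apply: eq_bigr => q _; rewrite !mxE.
  by rewrite [S t q j * _]mulrC mulrA -[U t i q * _ * _]mulrA flip2 mulr1.
Qed.

End SingularValueFlow.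

Theorem theorem3 (R : realType) (N : nat) (dim : nat -> nat)
    (l : 'M[R]_(dim N, dim 0%N) -> R) (W : R -> factors R dim)
    (U : R -> 'M[R]_(dim N, minn (dim N) (dim 0%N)))
    (S : R -> 'M[R]_(minn (dim N) (dim 0%N)))
    (V : R -> 'M[R]_(dim 0%N, minn (dim N) (dim 0%N)))
    (hN : (1 <= N)%N)
    (hl : analytic l)
    (hflow : gradient_flow l W)
    (hbal : balanced N (W 0))
    (hsvd : analytic_svd (fun t => product_matrix (W t) N) U S V) :
  (forall (r : 'I_(minn (dim N) (dim 0%N))) (t : R), 0 <= t ->
     has_derivative_ge0 (fun s => S s r r : R) t
       (- (N%:R * ((S t r r ^+ 2) `^ (1 - N%:R^-1))
           * mxdot (gradient l (product_matrix (W t) N))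
               (col r (U t) *m (col r (V t))^T))))
  /\
  ((2 <= N)%N ->
     exists (U' : R -> 'M[R]_(dim N, minn (dim N) (dim 0%N)))
            (S' : R -> 'M[R]_(minn (dim N) (dim 0%N)))
            (V' : R -> 'M[R]_(dim 0%N, minn (dim N) (dim 0%N))),
       analytic_svd (fun t => product_matrix (W t) N) U' S' V' /\
       (forall (r : 'I_(minn (dim N) (dim 0%N))) (t : R),
          0 <= t -> 0 <= S' t r r)).
Proof.
case: N => [//|n] in l U S V hN hl hflow hbal hsvd *; split => [r t t0|n1].
  exact: singular_value_speed.
exact: nonnegative_analytic_svd hl hflow hbal hsvd n1.
Qed.
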